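(* For all integers $p,q,m,n\ge 0$ and all $z\in\mathbb{C}$, $$H_{p+m,q+n}(z,\overline{z})=p!\,q!\,m!\,n!\sum_{j=0}^{\min(p,n)}\ \sum_{k=0}^{\min(q,m)}\frac{(-1)^{j+k}}{j!\,k!}\,\frac{H_{p-j,q-k}(z,\overline{z})}{(p-j)!\,(q-k)!}\,\frac{H_{m-k,n-j}(z,\overline{z})}{(m-k)!\,(n-j)!}.$$
   Context: For $z=x+iy\in\mathbb{C}$, $\partial_z=\frac12\left(\frac{\partial}{\partial x}-i\frac{\partial}{\partial y}\right)$ and $\partial_{\overline{z}}=\frac12\left(\frac{\partial}{\partial x}+i\frac{\partial}{\partial y}\right)$. The complex Hermite polynomials are, for integers $p,q\ge 0$, $$H_{p,q}(z,\overline{z})=(-1)^{p+q}e^{z\overline{z}}\,\partial_{\overline{z}}^{p}\partial_z^{q}\left(e^{-z\overline{z}}\right).$$ *)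

(* Defs.v *)
From Stdlib Require Import Reals Factorial.
From Coquelicot Require Import Coquelicot.

Open Scope C_scope.

Definition Cexp (z : C) : C :=
  RtoC (exp (Re z)) * (cos (Im z), sin (Im z)).

(* Partial derivatives of a complex-valued function of z = x + iy with respect
   to the real variables x and y, taken on real and imaginary parts. [Derive] is
   total; its value is meaningful where the function is differentiable. *)
Definition partial_x (f : C -> C) (z : C) : C :=
  (Derive (fun t : R => Re (f (t, Im z))) (Re z),
   Derive (fun t : R => Im (f (t, Im z))) (Re z)).

Definition partial_y (f : C -> C) (z : C) : C :=
  (Derive (fun t : R => Re (f (Re z, t))) (Im z),
   Derive (fun t : R => Im (f (Re z, t))) (Im z)).

Definition partial_z (f : C -> C) (z : C) : C :=
  RtoC (/ 2) * (partial_x f z - Ci * partial_y f z).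

Definition partial_zbar (f : C -> C) (z : C) : C :=
  RtoC (/ 2) * (partial_x f z + Ci * partial_y f z).

Definition hermite (p q : nat) (z : C) : C :=
  RtoC (-1) ^ (p + q) * Cexp (z * Cconj z)
  * Nat.iter p partial_zbar
      (Nat.iter q partial_z (fun w : C => Cexp (- (w * Cconj w)))) z.

Definition Cfact (n : nat) : C := RtoC (INR (fact n)).

(* Main.v *)
Require Import Defs.
From Stdlib Require Import Reals Factorial.
From Coquelicot Require Import Coquelicot.
From Stdlib Require Import Lia FunctionalExtensionality.
Open Scope C_scope.

(** Differentiating the Gaussian gives the three-term recurrences
    [H_{p+1,q} = z H_{p,q} - q H_{p,q-1}] and [H_{p,q+1} = w H_{p,q} - p H_{p-1,q}]
    with [w] the conjugate of [z].  The double sum on the right-hand side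
    contracts [p] with [n] and [q] with [m], each contracted pair contributing
    -1.  Removing one of the [p] points, which is either left free or contracted
    with one of the [n] points, shows that this sum obeys the first recurrence
    in [p + m]; at [p = 0] the second one is treated in the same way. *)

(** * Wirtinger calculus through real partial derivatives *)

(* [a] and [b] are the derivatives of [f] with respect to [z] and its conjugate. *)
Definition is_wirtinger (f : C -> C) (z a b : C) : Prop :=
  is_derive (fun t : R => Re (f (t, Im z))) (Re z) (Re (a + b)) /\
  is_derive (fun t : R => Im (f (t, Im z))) (Re z) (Im (a + b)) /\
  is_derive (fun t : R => Re (f (Re z, t))) (Im z) (Re (Ci * (a - b))) /\
  is_derive (fun t : R => Im (f (Re z, t))) (Im z) (Im (Ci * (a - b))).

Lemma is_wirtinger_partial_z f z a b :
  is_wirtinger f z a b -> partial_z f z = a.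
Proof.
  intros (H1 & H2 & H3 & H4).
  unfold partial_z, partial_x, partial_y.
  rewrite (is_derive_unique _ _ _ H1), (is_derive_unique _ _ _ H2).
  rewrite (is_derive_unique _ _ _ H3), (is_derive_unique _ _ _ H4).
  destruct a, b; apply injective_projections; simpl; field.
Qed.

Lemma is_wirtinger_partial_zbar f z a b :
  is_wirtinger f z a b -> partial_zbar f z = b.
Proof.
  intros (H1 & H2 & H3 & H4).
  unfold partial_zbar, partial_x, partial_y.
  rewrite (is_derive_unique _ _ _ H1), (is_derive_unique _ _ _ H2).
  rewrite (is_derive_unique _ _ _ H3), (is_derive_unique _ _ _ H4).
  destruct a, b; apply injective_projections; simpl; field.
Qed.

Lemma is_derive_eq (f : R -> R) (x l l' : R) :
  is_derive f x l -> l = l' -> is_derive f x l'.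
Proof. now intros H <-. Qed.

Lemma is_wirtinger_const c z : is_wirtinger (fun _ => c) z 0 0.
Proof.
  split; [| split; [| split]];
    (eapply is_derive_eq; [apply (is_derive_const (V := R_NormedModule)) |]);
    unfold zero; simpl; ring.
Qed.

Lemma is_wirtinger_id z : is_wirtinger (fun w => w) z 1 0.
Proof. split; [| split; [| split]]; simpl; auto_derive; auto; ring. Qed.

Lemma is_wirtinger_conj z : is_wirtinger Cconj z 0 1.
Proof. split; [| split; [| split]]; simpl; auto_derive; auto; ring. Qed.

Lemma is_wirtinger_plus f g z a b c d :
  is_wirtinger f z a b -> is_wirtinger g z c d ->
  is_wirtinger (fun w => f w + g w) z (a + c) (b + d).
Proof.
  intros (F1 & F2 & F3 & F4) (G1 & G2 & G3 & G4).
  split; [| split; [| split]];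
    [ eapply is_derive_eq; [exact (is_derive_plus _ _ _ _ _ F1 G1) |]
    | eapply is_derive_eq; [exact (is_derive_plus _ _ _ _ _ F2 G2) |]
    | eapply is_derive_eq; [exact (is_derive_plus _ _ _ _ _ F3 G3) |]
    | eapply is_derive_eq; [exact (is_derive_plus _ _ _ _ _ F4 G4) |] ];
    unfold plus; simpl; ring.
Qed.

Lemma is_wirtinger_mult f g z a b c d :
  is_wirtinger f z a b -> is_wirtinger g z c d ->
  is_wirtinger (fun w => f w * g w) z (a * g z + f z * c) (b * g z + f z * d).
Proof.
  intros (F1 & F2 & F3 & F4) (G1 & G2 & G3 & G4).
  assert (M : forall u v x du dv, is_derive u x du -> is_derive v x dv ->
    is_derive (fun t => u t * v t)%R x (du * v x + u x * dv)%R).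
  { intros u v x du dv Hu Hv.
    apply (is_derive_mult u v x du dv Hu Hv). intros; apply Rmult_comm. }
  destruct z as [x y].
  split; [| split; [| split]].
  (* The real part of a product is a difference of products of real and imaginary parts, the
     imaginary part a sum; [M] is applied to each product. *)
  - eapply is_derive_eq;
      [exact (is_derive_minus _ _ _ _ _ (M _ _ _ _ _ F1 G1) (M _ _ _ _ _ F2 G2)) |].
    unfold minus, plus, opp; simpl. unfold Re, Im. ring.
  - eapply is_derive_eq;
      [exact (is_derive_plus _ _ _ _ _ (M _ _ _ _ _ F1 G2) (M _ _ _ _ _ F2 G1)) |].
    unfold minus, plus, opp; simpl. unfold Re, Im. ring.
  - eapply is_derive_eq;
      [exact (is_derive_minus _ _ _ _ _ (M _ _ _ _ _ F3 G3) (M _ _ _ _ _ F4 G4)) |].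
    unfold minus, plus, opp; simpl. unfold Re, Im. ring.
  - eapply is_derive_eq;
      [exact (is_derive_plus _ _ _ _ _ (M _ _ _ _ _ F3 G4) (M _ _ _ _ _ F4 G3)) |].
    unfold minus, plus, opp; simpl. unfold Re, Im. ring.
Qed.

Lemma is_wirtinger_eq f z a b a' b' :
  is_wirtinger f z a b -> a = a' -> b = b' -> is_wirtinger f z a' b'.
Proof. now intros H <- <-. Qed.

(** * The Gaussian and its first derivatives *)

Definition gauss (w : C) : C := Cexp (- (w * Cconj w)).

Lemma gauss_real (x y : R) : gauss (x, y) = RtoC (exp (- (x * x + y * y))).
Proof.
  unfold gauss, Cexp, Cconj; simpl.
  replace (- (x * - y + y * x))%R with 0%R by ring.
  replace (- (x * x - y * - y))%R with (- (x * x + y * y))%R by ring.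
  rewrite cos_0, sin_0.
  apply injective_projections; simpl; ring.
Qed.

Lemma Cexp_gauss (z : C) : Cexp (z * Cconj z) * gauss z = 1.
Proof.
  destruct z as [x y]. rewrite gauss_real.
  unfold Cexp, Cconj; simpl.
  replace (x * - y + y * x)%R with 0%R by ring.
  replace (x * x - y * - y)%R with (x * x + y * y)%R by ring.
  rewrite cos_0, sin_0.
  apply injective_projections; simpl.
  - rewrite exp_Ropp. field. apply Rgt_not_eq, exp_pos.
  - ring.
Qed.

Lemma is_wirtinger_gauss z :
  is_wirtinger gauss z (- Cconj z * gauss z) (- z * gauss z).
Proof.
  destruct z as [x y]. rewrite gauss_real.
  split; [| split; [| split]]; cbn [Re Im fst snd];
    (eapply is_derive_ext; [intros t; rewrite gauss_real; reflexivity |]);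
    simpl; auto_derive; auto; ring.
Qed.

(** * The Hermite polynomials in [z] and its conjugate *)

(* [w] stands for the conjugate of [z]; at [q = 0] the truncated index [q - 1]
   is harmless because its coefficient vanishes. *)
Fixpoint hpoly (p q : nat) (z w : C) : C :=
  match p with
  | O => w ^ q
  | S p' => z * hpoly p' q z w - RtoC (INR q) * hpoly p' (q - 1) z w
  end.

Lemma RtoC_m1 : RtoC (-1) = - (1).
Proof. apply injective_projections; simpl; ring. Qed.

Lemma RtoC_INR_S (n : nat) : RtoC (INR (S n)) = RtoC (INR n) + 1.
Proof. now rewrite S_INR, RtoC_plus. Qed.

(** The recursion of [hpoly] treats [p] and [q] asymmetrically; this restores the symmetry, because
    raising one index commutes with raising the other. *)
Lemma hpoly_Sr (p q : nat) (z w : C) :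
  hpoly p (S q) z w = w * hpoly p q z w - RtoC (INR p) * hpoly (p - 1) q z w.
Proof.
  revert q; induction p as [| p IH]; intros q.
  - simpl. ring.
  - change (hpoly (S p) (S q) z w) with
      (z * hpoly p (S q) z w - RtoC (INR (S q)) * hpoly p (S q - 1) z w).
    replace (S q - 1)%nat with q by lia.
    replace (S p - 1)%nat with p by lia.
    change (hpoly (S p) q z w) with
      (z * hpoly p q z w - RtoC (INR q) * hpoly p (q - 1) z w).
    rewrite (IH q), !RtoC_INR_S.
    (* [E] is the induction hypothesis one step down in [q], [F] the defining recursion one step
       down in [p]; the factors [INR q] and [INR p] absorb the zero cases. *)
    assert (E : RtoC (INR q) * (w * hpoly p (q - 1) z w) =
                RtoC (INR q) * (hpoly p q z w
                  + RtoC (INR p) * hpoly (p - 1) (q - 1) z w)).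
    { destruct q as [| q]; [simpl; ring |].
      replace (S q - 1)%nat with q by lia. rewrite (IH q). ring. }
    assert (F : RtoC (INR p) * (z * hpoly (p - 1) q z w) =
                RtoC (INR p) * (hpoly p q z w
                  + RtoC (INR q) * hpoly (p - 1) (q - 1) z w)).
    { destruct p as [| p]; [simpl; ring |].
      replace (S p - 1)%nat with p by lia. simpl. ring. }
    transitivity (w * z * hpoly p q z w - RtoC (INR p) * (z * hpoly (p - 1) q z w)
                  - (RtoC (INR q) + 1) * hpoly p q z w); [ring |].
    transitivity (w * z * hpoly p q z w - RtoC (INR q) * (w * hpoly p (q - 1) z w)
                  - (RtoC (INR p) + 1) * hpoly p q z w); [| ring].
    rewrite E, F. ring.
Qed.

(** The polynomials differentiate like the monomials [z ^ p * w ^ q]: differentiating the recursion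
    in [p] reproduces the same recursion at lower indices. *)
Lemma is_wirtinger_hpoly (p q : nat) (z : C) :
  is_wirtinger (fun w => hpoly p q w (Cconj w)) z
    (RtoC (INR p) * hpoly (p - 1) q z (Cconj z))
    (RtoC (INR q) * hpoly p (q - 1) z (Cconj z)).
Proof.
  revert q; induction p as [| p IH]; intros q.
  - induction q as [| q IHq].
    + simpl. rewrite !Cmult_0_l. apply is_wirtinger_const.
    + change (fun w => hpoly 0 (S q) w (Cconj w))
        with (fun w => Cconj w * hpoly 0 q w (Cconj w)).
      eapply is_wirtinger_eq;
        [exact (is_wirtinger_mult _ _ _ _ _ _ _ (is_wirtinger_conj z) IHq) | |].
      * simpl. ring.
      * rewrite RtoC_INR_S. replace (S q - 1)%nat with q by lia.
        destruct q as [| q]; [simpl; ring |].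
        replace (S q - 1)%nat with q by lia. simpl hpoly. ring.
  - replace (fun w => hpoly (S p) q w (Cconj w)) with
      (fun w => w * hpoly p q w (Cconj w)
                + - RtoC (INR q) * hpoly p (q - 1) w (Cconj w))
      by (apply functional_extensionality; intros w; simpl; ring).
    eapply is_wirtinger_eq.
    + exact (is_wirtinger_plus _ _ _ _ _ _ _
        (is_wirtinger_mult _ _ _ _ _ _ _ (is_wirtinger_id z) (IH q))
        (is_wirtinger_mult _ _ _ _ _ _ _
          (is_wirtinger_const (- RtoC (INR q)) z) (IH (q - 1)%nat))).
    + rewrite RtoC_INR_S. replace (S p - 1)%nat with p by lia.
      destruct p as [| p]; [simpl; ring |].
      replace (S p - 1)%nat with p by lia. simpl hpoly. ring.
    + change (hpoly (S p) (q - 1) z (Cconj z)) with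
        (z * hpoly p (q - 1) z (Cconj z)
         - RtoC (INR (q - 1)) * hpoly p (q - 1 - 1) z (Cconj z)).
      cbv beta. ring.
Qed.

(** * Iterated derivatives of the Gaussian *)

Lemma iter_partial_z_gauss (q : nat) :
  Nat.iter q partial_z gauss =
  fun w => RtoC (-1) ^ q * hpoly 0 q w (Cconj w) * gauss w.
Proof.
  induction q as [| q IH]; apply functional_extensionality; intros z.
  - simpl. ring.
  - simpl Nat.iter. rewrite IH.
    erewrite is_wirtinger_partial_z;
      [| exact (is_wirtinger_mult _ _ _ _ _ _ _
           (is_wirtinger_mult _ _ _ _ _ _ _ (is_wirtinger_const _ z)
              (is_wirtinger_hpoly 0 q z)) (is_wirtinger_gauss z))].
    simpl. rewrite !RtoC_m1. ring.
Qed.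

(** By the product rule a further derivative gives [q] times the lowered polynomial minus [z] times
    the polynomial, which up to sign is the recursion of [hpoly]. *)
Lemma iter_partial_zbar_gauss (p q : nat) :
  Nat.iter p partial_zbar (Nat.iter q partial_z gauss) =
  fun w => RtoC (-1) ^ (p + q) * hpoly p q w (Cconj w) * gauss w.
Proof.
  induction p as [| p IH]; [exact (iter_partial_z_gauss q) |].
  apply functional_extensionality; intros z.
  simpl Nat.iter. rewrite IH.
  erewrite is_wirtinger_partial_zbar;
    [| exact (is_wirtinger_mult _ _ _ _ _ _ _
         (is_wirtinger_mult _ _ _ _ _ _ _ (is_wirtinger_const _ z)
            (is_wirtinger_hpoly p q z)) (is_wirtinger_gauss z))].
  simpl. rewrite !RtoC_m1. ring.
Qed.

Lemma hermite_hpoly (p q : nat) (z : C) : hermite p q z = hpoly p q z (Cconj z).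
Proof.
  unfold hermite. fold gauss. rewrite iter_partial_zbar_gauss.
  transitivity (RtoC (-1) ^ (p + q) * RtoC (-1) ^ (p + q)
    * (Cexp (z * Cconj z) * gauss z) * hpoly p q z (Cconj z)); [ring |].
  rewrite Cexp_gauss, <- Cpow_mult_l, <- RtoC_mult.
  replace (-1 * -1)%R with 1%R by ring.
  rewrite Cpow_1_l. ring.
Qed.

(** * Weighted sums over partial matchings *)

(* The weighted sum of [F (free points of p) (free points of n)] over the partial
   matchings of [p] points with [n] points, each matched pair weighing -1; the
   recursion splits on the fate of one of the [p] points. *)
Fixpoint contract (p n : nat) (F : nat -> nat -> C) : C :=
  match p with
  | O => F O n
  | S p' => contract p' n (fun a b => F (S a) b)
            - RtoC (INR n) * contract p' (n - 1) F
  end.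

Lemma contract_lin (p n : nat) (x y : C) (F G : nat -> nat -> C) :
  contract p n (fun a b => x * F a b + y * G a b) =
  x * contract p n F + y * contract p n G.
Proof.
  revert n F G; induction p as [| p IH]; intros n F G; simpl; [reflexivity |].
  rewrite (IH n (fun a b => F (S a) b) (fun a b => G (S a) b)), IH. ring.
Qed.

Lemma contract_ext (p n : nat) (F G : nat -> nat -> C) :
  (forall a b, F a b = G a b) -> contract p n F = contract p n G.
Proof.
  revert n F G; induction p as [| p IH]; intros n F G H; simpl; [apply H |].
  rewrite (IH n _ (fun a b => G (S a) b)), (IH _ F G); auto.
Qed.

(** Double counting: marking a free point of a matching and deleting it amounts to choosing any of
    the [p] points and matching the others. *)
Lemma contract_pred (p n : nat) (F : nat -> nat -> C) :
  contract p n (fun a b => RtoC (INR a) * F (a - 1)%nat b) =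
  RtoC (INR p) * contract (p - 1) n F.
Proof.
  revert n F; induction p as [| p IH]; intros n F.
  - simpl. ring.
  - cbn [contract]. rewrite IH. replace (S p - 1)%nat with p by lia.
    (* The marked free point is either the newly added one, the term with coefficient 1, or one of
       the [a] others, to which the induction hypothesis applies. *)
    rewrite (contract_ext p n _
      (fun a b => 1 * F a b
         + 1 * (RtoC (INR a) * (fun a b => F (S a) b) (a - 1)%nat b))).
    + rewrite contract_lin, (IH n (fun a b => F (S a) b)), RtoC_INR_S.
      destruct p as [| p]; [simpl; ring |].
      replace (S p - 1)%nat with p by lia. cbn [contract]. ring.
    + intros a b. cbv beta. rewrite RtoC_INR_S. replace (S a - 1)%nat with a by lia.
      destruct a as [| a]; [simpl; ring |].
      replace (S a - 1)%nat with a by lia. ring.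
Qed.

Lemma contract_scal (p n : nat) (x : C) (F : nat -> nat -> C) :
  contract p n (fun a b => x * F a b) = x * contract p n F.
Proof.
  rewrite (contract_ext p n _ (fun a b => x * F a b + 0 * F a b)).
  - rewrite contract_lin. ring.
  - intros; ring.
Qed.

(** * The addition formula in terms of matchings *)

Lemma hpoly_add_r (q m n : nat) (z w : C) :
  hpoly m (q + n) z w =
  contract q m (fun b c => hpoly 0 b z w * hpoly c n z w).
Proof.
  revert m; induction q as [| q IH]; intros m; cbn [contract].
  - simpl. ring.
  (* In [hpoly_Sr] the term with factor [w] leaves the new point free; the term with factor [INR m]
     contracts it with one of the [m] points. *)
  - rewrite <- IH. simpl Nat.add. rewrite hpoly_Sr, IH, <- contract_scal.
    f_equal. apply contract_ext. intros b c. simpl. ring.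
Qed.

Lemma hpoly_add (p q m n : nat) (z w : C) :
  hpoly (p + m) (q + n) z w =
  contract p n (fun a d =>
    contract q m (fun b c => hpoly a b z w * hpoly c d z w)).
Proof.
  revert q n; induction p as [| p IH]; intros q n.
  - apply hpoly_add_r.
  - simpl Nat.add. simpl hpoly at 1. cbn [contract].
    (* If the new point stays free, the recursion for the first factor gives [z] times the old sum
       minus a term weighted by [b], which [contract_pred] turns into a factor [q]. *)
    rewrite (contract_ext p n _ (fun a d =>
      z * contract q m (fun b c => hpoly a b z w * hpoly c d z w)
      + (- RtoC (INR q))
        * contract (q - 1) m (fun b c => hpoly a b z w * hpoly c d z w))).
    + rewrite contract_lin, <- !IH, plus_INR, RtoC_plus.
      (* The coefficient [q + n] splits into contractions within the first factor and contractions
         with the [n] points. The truncated indices can differ only where the coefficient is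
         zero. *)
      assert (E : RtoC (INR q) * hpoly (p + m) (q + n - 1) z w =
                  RtoC (INR q) * hpoly (p + m) (q - 1 + n) z w).
      { destruct q as [| q]; [simpl; ring |]. do 2 f_equal. lia. }
      assert (F : RtoC (INR n) * hpoly (p + m) (q + n - 1) z w =
                  RtoC (INR n) * hpoly (p + m) (q + (n - 1)) z w).
      { destruct n as [| n]; [simpl; ring |]. do 2 f_equal. lia. }
      rewrite Cmult_plus_distr_r, E, F. ring.
    + intros a d.
      transitivity (z * contract q m (fun b c => hpoly a b z w * hpoly c d z w)
        + - (1) * contract q m (fun b c => RtoC (INR b)
            * (fun b c => hpoly a b z w * hpoly c d z w) (b - 1)%nat c)).
      * rewrite <- contract_lin. apply contract_ext. intros b c. simpl hpoly. ring.
      * rewrite (contract_pred q m (fun b c => hpoly a b z w * hpoly c d z w)). ring.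
Qed.

(** * Closed form of the matching weights *)

Lemma Cfact_neq_0 (n : nat) : Cfact n <> 0.
Proof.
  unfold Cfact. intros H. apply RtoC_inj in H. now apply INR_fact_neq_0 in H.
Qed.

Lemma Cfact_S (n : nat) : Cfact (S n) = RtoC (INR (S n)) * Cfact n.
Proof. unfold Cfact. now rewrite fact_simpl, mult_INR, RtoC_mult. Qed.

(** The signed number of matchings with exactly [j] pairs, [(-1)^j j! binom(p,j) binom(n,j)], by the
    same case split as in [contract]. *)
Fixpoint weight (p n j : nat) : C :=
  match p, j with
  | O, O => 1
  | O, S _ => 0
  | S p', O => weight p' n O
  | S p', S i => weight p' n (S i) - RtoC (INR n) * weight p' (n - 1) i
  end.

Lemma weight_0 (p n : nat) : weight p n 0 = 1.
Proof. induction p as [| p IH]; [reflexivity | exact IH]. Qed.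

Lemma weight_out (p n j : nat) : (p < j)%nat \/ (n < j)%nat -> weight p n j = 0.
Proof.
  revert n j; induction p as [| p IH]; intros n [| j] H; try lia.
  - reflexivity.
  - cbn [weight]. rewrite IH by lia.
    destruct n as [| n]; [simpl; ring |].
    rewrite IH by lia. ring.
Qed.

Lemma weight_closed (p n j : nat) : (j <= p)%nat -> (j <= n)%nat ->
  weight p n j =
  Cfact p * Cfact n * (RtoC (-1) ^ j / Cfact j / (Cfact (p - j) * Cfact (n - j))).
Proof.
  assert (F0 : Cfact 0 = 1) by reflexivity.
  assert (NZ : forall k, RtoC (INR (S k)) <> 0).
  { intros k H. apply RtoC_inj in H. now apply not_0_INR in H. }
  revert n j; induction p as [| p IH]; intros n [| i] Hp Hn; try lia.
  - simpl. rewrite Nat.sub_0_r, F0. field. repeat split; apply Cfact_neq_0.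
  - rewrite weight_0, !Nat.sub_0_r, F0. simpl Cpow.
    field. repeat split; apply Cfact_neq_0.
  - destruct n as [| n]; [lia |].
    assert (Hn' : (i <= n)%nat) by lia.
    cbn [weight]. simpl Nat.sub. rewrite Nat.sub_0_r, (IH n i) by lia.
    destruct (Nat.eq_dec i p) as [-> | Hi].
    + rewrite weight_out, Nat.sub_diag, F0, !Cfact_S by lia. simpl Cpow.
      rewrite RtoC_m1. field.
      repeat split; apply Cfact_neq_0 || apply NZ.
    + rewrite IH by lia. simpl Nat.sub.
      replace (p - i)%nat with (S (p - S i)) by lia.
      (* Over a common denominator the two summands contribute [p - i] and [i + 1], which add up to
         [p + 1]. *)
      assert (E : RtoC (INR (S p)) = RtoC (INR (S (p - S i))) + RtoC (INR (S i))).
      { rewrite <- RtoC_plus, <- plus_INR. do 2 f_equal. lia. }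
      rewrite !Cfact_S, E. simpl Cpow. rewrite RtoC_m1. field.
      repeat split; apply Cfact_neq_0 || apply NZ.
Qed.

(** * From matchings to finite sums *)

(* [sum_n_ext] leaves an equation in a canonical-structure carrier, on which
   [ring] and [field] fail; here it is an equation in [C]. *)
Lemma sum_n_Cext (u v : nat -> C) (N : nat) :
  (forall j, u j = v j) -> sum_n u N = sum_n v N.
Proof. apply sum_n_ext. Qed.

Lemma sum_n_Cmult_l (c : C) (u : nat -> C) (N : nat) :
  sum_n (fun j => c * u j) N = c * sum_n u N.
Proof.
  induction N as [| N IH]; [now rewrite !sum_O |].
  rewrite !sum_Sn, IH. unfold plus; simpl. ring.
Qed.

Lemma sum_n_Cfirst (u : nat -> C) (N : nat) :
  sum_n u (S N) = plus (u O) (sum_n (fun j => u (S j)) N).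
Proof.
  induction N as [| N IH]; [now rewrite sum_Sn, !sum_O |].
  rewrite sum_Sn, IH, sum_Sn. symmetry. apply plus_assoc.
Qed.

(** Matchings are grouped by their number [j] of pairs, which determines the numbers of free points;
    for [j] above [n] the truncated [n - j] is harmless, as the weight is zero. *)
Lemma contract_weight (p n : nat) (F : nat -> nat -> C) :
  contract p n F = sum_n (fun j => weight p n j * F (p - j)%nat (n - j)%nat) p.
Proof.
  revert n F; induction p as [| p IH]; intros n F.
  - rewrite sum_O. simpl. rewrite Nat.sub_0_r. ring.
  - cbn [contract]. rewrite !IH.
    (* The first sum is extended by a zero term at [j = S p]; splitting off [j = 0] then aligns it
       with the second sum, shifted by one pair. *)
    transitivity (plus (sum_n (fun j => weight p n j * F (S p - j)%nat (n - j)%nat) (S p))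
      (- RtoC (INR n) * sum_n (fun j =>
         weight p (n - 1) j * F (p - j)%nat (n - 1 - j)%nat) p)).
    + rewrite sum_Sn, (weight_out p n (S p)) by lia.
      rewrite (sum_n_ext_loc _
        (fun j => weight p n j * F (S p - j)%nat (n - j)%nat) p).
      * unfold plus; simpl. ring.
      * intros j Hj. do 2 f_equal. lia.
    + rewrite <- sum_n_Cmult_l, !sum_n_Cfirst, <- plus_assoc.
      rewrite <- sum_n_plus.
      f_equal. apply sum_n_Cext. intros j. cbn [weight]. simpl Nat.sub.
      replace (n - 1 - j)%nat with (n - S j)%nat by lia.
      unfold plus; simpl. ring.
Qed.

Lemma sum_n_trunc (u : nat -> C) (N M : nat) :
  (N <= M)%nat -> (forall j, (N < j)%nat -> u j = 0) -> sum_n u M = sum_n u N.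
Proof.
  intros HM H. induction HM as [| M HM IH]; [reflexivity |].
  rewrite sum_Sn, IH, H by lia. apply Cplus_0_r.
Qed.

Lemma contract_sum (p n : nat) (F : nat -> nat -> C) :
  contract p n F = Cfact p * Cfact n *
    sum_n (fun j => RtoC (-1) ^ j / Cfact j / (Cfact (p - j) * Cfact (n - j))
      * F (p - j)%nat (n - j)%nat) (Nat.min p n).
Proof.
  rewrite contract_weight.
  rewrite (sum_n_trunc _ (Nat.min p n) p); [| lia |].
  - rewrite <- sum_n_Cmult_l.
    apply sum_n_ext_loc. intros j Hj. rewrite weight_closed by lia.
    symmetry. apply Cmult_assoc.
  - intros j Hj. rewrite weight_out by lia. ring.
Qed.

Theorem proposition3p2 :
  forall (p q m n : nat) (z : C),
    hermite (p + m) (q + n) z =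
    Cfact p * Cfact q * Cfact m * Cfact n *
    sum_n (fun j : nat =>
      sum_n (fun k : nat =>
        RtoC (-1) ^ (j + k) / (Cfact j * Cfact k)
        * (hermite (p - j) (q - k) z / (Cfact (p - j) * Cfact (q - k)))
        * (hermite (m - k) (n - j) z / (Cfact (m - k) * Cfact (n - j))))
      (Nat.min q m))
    (Nat.min p n).
Proof.
  intros p q m n z.
  rewrite hermite_hpoly, hpoly_add, contract_sum.
  (* [Cfact p * Cfact n] belongs to the outer contraction and [Cfact q * Cfact m] to the inner
     one. *)
  transitivity (Cfact p * Cfact n * (Cfact q * Cfact m *
    sum_n (fun j : nat =>
      sum_n (fun k : nat =>
        RtoC (-1) ^ (j + k) / (Cfact j * Cfact k)
        * (hermite (p - j) (q - k) z / (Cfact (p - j) * Cfact (q - k)))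
        * (hermite (m - k) (n - j) z / (Cfact (m - k) * Cfact (n - j))))
      (Nat.min q m))
    (Nat.min p n))); [f_equal | ring].
  rewrite <- sum_n_Cmult_l. apply sum_n_Cext. intros j.
  rewrite contract_sum.
  transitivity (Cfact q * Cfact m
    * ((RtoC (-1) ^ j / Cfact j / (Cfact (p - j) * Cfact (n - j)))
      * sum_n (fun k => RtoC (-1) ^ k / Cfact k / (Cfact (q - k) * Cfact (m - k))
         * (hpoly (p - j) (q - k) z (Cconj z) * hpoly (m - k) (n - j) z (Cconj z)))
         (Nat.min q m))); [ring |].
  f_equal. rewrite <- sum_n_Cmult_l. apply sum_n_Cext. intros k.
  rewrite !hermite_hpoly, Cpow_add_r.
  field. repeat split; apply Cfact_neq_0.
Qed.
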